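(* Let $X$ be an infinite-dimensional Banach space such that $\mathrm{PC}(B_X)$ is weakly dense in $B_X$ (for instance, if $X$ has the convex point of continuity property). If $x\in S_X$ is a point of Gâteaux differentiability of the norm of $X$, then $x$ is not a super AD point.
   Context: Banach spaces are over $\mathbb{K}$ ($\mathbb{R}$ or $\mathbb{C}$); $B_X$, $S_X$ denote the closed unit ball and the unit sphere of $X$; $\mathbb{T}=\{\theta\in\mathbb{K}:|\theta|=1\}$. $\mathrm{PC}(A)$ is the set of points of continuity of $A$, i.e. points of $A$ at which the identity $(A,\text{weak})\to(A,\|\cdot\|)$ is continuous. $X$ has the convex point of continuity property if every non-empty closed convex bounded subset of $X$ has a point of continuity. A point $x\in S_X$ is a point of Gâteaux differentiability of the norm if there exists a unique $f\in S_{X^*}$ with $f(x)=1$. A point $x\in S_X$ is a super AD point if $\sup_{y\in W}\max_{\theta\in\mathbb{T}}\|x+\theta y\|=2$ for every non-empty relatively weakly open subset $W$ of $B_X$ with $W\cap S_X\neq\emptyset$. *)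

(* Defs.v *)
From HB Require Import structures.
From mathcomp Require Import all_boot all_order all_algebra.
From mathcomp Require Import all_classical all_reals all_analysis.
From mathcomp Require Import complex.

Set Implicit Arguments.
Unset Strict Implicit.
Unset Printing Implicit Defensive.

Import Order.TTheory GRing.Theory Num.Theory.
Import numFieldNormedType.Exports.

Local Open Scope classical_set_scope.
Local Open Scope ring_scope.

(* Over K = R[i], norms take their values in R[i] and are nonnegative reals;
   z <= w in R[i] means that w - z is a nonnegative real. Hence least upper
   bounds and maxima in K of nonempty sets of norms are the usual ones in R. *)
Definition real_or_complex (R : realType) (K : numFieldType) : Prop :=
  K = R \/ K = R[i].

Definition is_max (d : Order.disp_t) (T : porderType d) (A : set T) (m : T) :=
  A m /\ ubound A m.

Section Banach.
Variables (K : numFieldType) (X : completeNormedModType K).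

Definition infinite_dimensional : Prop :=
  ~ exists (n : nat) (e : 'I_n -> X),
      forall x : X, exists c : 'I_n -> K, x = \sum_(i < n) c i *: e i.

Definition unit_ball : set X := [set x | `|x| <= 1].

Definition unit_sphere : set X := [set x | `|x| = 1].

Definition dual : set (X -> K^o) := [set f | linear f /\ continuous f].

Definition dual_sphere : set (X -> K^o) :=
  [set f | dual f /\ isLub [set `|f y| | y in unit_ball] (1 : K)].

(* The carrier X with the weak topology sigma(X, X* ). *)
Definition weak : topologicalType :=
  sup_topology (fun f : dual =>
    Topological.class (initial_topology (\val f : X -> K^o))).

Definition PC (A : set X) : set X :=
  [set x | A x /\ (fun y : weak => y : X) @ within A (nbhs (x : weak)) --> x].

Definition weakly_dense_in (D A : set X) : Prop :=
  D `<=` A /\ A `<=` closure (D : set weak).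

Definition CPCP : Prop :=
  forall C : set X, C !=set0 -> closed C -> convex_set C -> bounded_set C ->
    PC C !=set0.

Definition gateaux_point (x : X) : Prop :=
  unit_sphere x /\ exists! f : X -> K^o, dual_sphere f /\ f x = 1.

Definition relatively_weakly_open (A W : set X) : Prop :=
  exists2 U : set weak, open U & W = U `&` A.

Definition super_AD (x : X) : Prop :=
  unit_sphere x /\
  forall W : set X, W !=set0 -> relatively_weakly_open unit_ball W ->
    W `&` unit_sphere !=set0 ->
    isLub [set m : K | exists2 y, W y &
             is_max [set `|x + theta *: y| | theta in [set t : K | `|t| = 1]] m]
          2.

End Banach.

Arguments weak {K} X.
Arguments unit_ball {K} X.
Arguments unit_sphere {K} X.

(* Main.v *)
(* If y is a point of continuity of B_X, then |y| = 1 because X is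
   infinite-dimensional, and y has weak neighbourhoods in B_X of arbitrarily
   small diameter; so if x is a super AD point, compactness of the unit circle
   of scalars yields theta with |x + theta y| = 2. A Hahn-Banach functional
   norming x + theta y has modulus 1 at both x and y, hence it is a multiple of
   the unique supporting functional f of x, and |f y| = 1. This contradicts the
   density of such y near 0. Under the convex point of continuity property,
   every weakly open set meeting B_X contains another one of small diameter; a
   nested sequence of these shrinks, by completeness, to a point of continuity. *)
Require Import Defs.
From HB Require Import structures.
From Stdlib Require List.
From mathcomp Require Import all_boot all_order all_algebra.
From mathcomp Require Import all_classical all_reals all_analysis.
From mathcomp Require Import complex.
From mathcomp Require Import lra ring.

Set Implicit Arguments.
Unset Strict Implicit.
Unset Printing Implicit Defensive.

Import Order.TTheory GRing.Theory Num.Theory.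
Import numFieldNormedType.Exports.

Local Open Scope classical_set_scope.
Local Open Scope ring_scope.

(** * The Hahn-Banach theorem *)

Section HahnBanach.
Context {R : realType} {V : lmodType R}.
Implicit Types (p q : V -> R) (v x y : V).

(** Homogeneity is asked only as an inequality; applying it again with [a^-1] gives the equality of
    [sublinear_pos]. *)
Definition sublinear p :=
  (forall x y, p (x + y) <= p x + p y) /\
  (forall a x, 0 <= a -> p (a *: x) <= a * p x).

Lemma sublinear0 p : sublinear p -> p 0 = 0.
Proof.
move=> [pD pZ]; apply/eqP; rewrite eq_le.
have := pZ 0 0 (lexx 0); rewrite scale0r mul0r => -> /=.
by have := pD 0 0; rewrite addr0; lra.
Qed.

Lemma sublinearN p x : sublinear p -> - p (- x) <= p x.
Proof.
move=> sp; have [pD _] := sp; have := pD x (- x).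
by rewrite subrr sublinear0//; lra.
Qed.

Lemma sublinear_pos p a x : sublinear p -> 0 <= a -> p (a *: x) = a * p x.
Proof.
move=> sp a0; have [_ pZ] := sp; apply/eqP; rewrite eq_le pZ//=.
have [->|an0] := eqVneq a 0; first by rewrite scale0r mul0r sublinear0.
have : p (a^-1 *: (a *: x)) <= a^-1 * p (a *: x) by rewrite pZ// invr_ge0.
rewrite scalerA mulVf// scale1r mulrC ler_pdivlMr ?lt_def ?an0//.
by rewrite mulrC.
Qed.

(* [shift q v] is sublinear and below [q]; if [q] is minimal, this forces
   [q x + q v <= q (x + v)]. Whatever linear map lies below [shift p v] agrees
   with [p] at [v]. *)
Definition shift q v x :=
  inf [set q (x + t *: v) - t * q v | t in [set t | 0 <= t]].

Lemma shift_nonempty q v x :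
  [set q (x + t *: v) - t * q v | t in [set t | 0 <= t]] !=set0.
Proof. by eexists; exists 0 => /=. Qed.

Lemma shift_has_lbound q v x : sublinear q ->
  has_lbound [set q (x + t *: v) - t * q v | t in [set t | 0 <= t]].
Proof.
move=> sq; exists (- q (- x)) => _ [t /= t0 <-].
have [qD _] := sq; have := qD (x + t *: v) (- x).
by rewrite addrAC subrr add0r sublinear_pos//; lra.
Qed.

Lemma shift_le q v x t : sublinear q -> 0 <= t ->
  shift q v x <= q (x + t *: v) - t * q v.
Proof. by move=> sq t0; apply: ge_inf; [exact: shift_has_lbound|exists t]. Qed.

Lemma le_shift q v x b :
  (forall t, 0 <= t -> b <= q (x + t *: v) - t * q v) -> b <= shift q v x.
Proof.
move=> H; apply: lb_le_inf; first exact: shift_nonempty.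
by move=> _ [t /= t0 <-]; exact: H.
Qed.

(** Parameters [s] for [x] and [t] for [y] combine into [s + t] for [x + y]; for [0 < a], the
    parameter [a * t] serves for [a *: x]. *)
Lemma shift_sublinear q v : sublinear q -> sublinear (shift q v).
Proof.
move=> sq; have [qD qZ] := sq; split=> [x y|a x].
  rewrite -lerBlDl; apply: le_shift => t t0.
  rewrite lerBlDr -lerBlDl; apply: le_shift => s s0.
  have := shift_le v (x + y) sq (addr_ge0 s0 t0).
  have := qD (x + s *: v) (y + t *: v).
  rewrite addrACA -scalerDl mulrDl; lra.
rewrite le_eqVlt => /predU1P[<-|a0].
  have := shift_le v 0 sq (lexx 0).
  by rewrite !scale0r !mul0r addr0 (sublinear0 sq) subr0.
rewrite -ler_pdivrMl//; apply: le_shift => t t0.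
rewrite ler_pdivrMl//.
have := shift_le v (a *: x) sq (mulr_ge0 (ltW a0) t0).
have := qZ a (x + t *: v) (ltW a0).
by rewrite scalerDr scalerA mulrBr mulrA; lra.
Qed.

Lemma shift_le_id q v x : sublinear q -> shift q v x <= q x.
Proof.
by move=> sq; have := shift_le v x sq (lexx 0); rewrite scale0r mul0r addr0 subr0.
Qed.

(** By Zorn's lemma: a nonempty chain is bounded by its pointwise infimum, finite because a
    sublinear map below [p] is at least [- p (- x)] at [x]. *)
Lemma minimal_sublinear p : sublinear p ->
  exists q, [/\ sublinear q, forall x, q x <= p x &
    forall q', sublinear q' -> (forall x, q' x <= q x) -> forall x, q x <= q' x].
Proof.
move=> sp.
pose T := {q | sublinear q /\ forall x, q x <= p x}.
pose p0 : T := exist _ p (conj sp (fun x => lexx (p x))).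
(* The order is reversed, so that a maximal element for [below] is a pointwise minimal map. *)
pose below (q r : T) := `[< forall x, sval r x <= sval q x >].
have [||A totA|[q [sq qp]] qmax] := @ZL_preorder T p0 below.
- by move=> q; apply/asboolP.
- move=> r s t /asboolP rs /asboolP st; apply/asboolP => x.
  exact: le_trans (st x) (rs x).
- have [[q0 Aq0]|A0] := pselect (A !=set0); last first.
    by exists p0 => s As; case: A0; exists s.
  pose I x := inf [set sval s x | s in A].
  have ne x : [set sval s x | s in A] !=set0 by eexists; exists q0.
  have lb x : has_lbound [set sval s x | s in A].
    exists (- p (- x)) => _ [s _ <-]; have [ss sple] := svalP s.
    by apply: le_trans (sublinearN x ss); rewrite lerN2.
  have I_le s x : A s -> I x <= sval s x by move=> As; apply: ge_inf => //; exists s.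
  have le_I x b : (forall s, A s -> b <= sval s x) -> b <= I x.
    by move=> H; apply: lb_le_inf => // _ [s As <-]; exact: H.
  have sI : sublinear I.
    split=> [x y|a x].
      rewrite -lerBlDl; apply: (le_I) => t At.
      rewrite lerBlDr -lerBlDl; apply: (le_I) => s As; rewrite lerBlDl.
      have [[sD _] _] := svalP s; have [[tD _] _] := svalP t.
      (* Subadditivity of the smaller of [s] and [t] bounds [I (x + y)] by [sval s x + sval t y]. *)
      have [/asboolP st|/asboolP ts] := totA _ _ As At.
        apply: (le_trans (I_le _ _ At)); apply: (le_trans (tD _ _)).
        by have := st x; lra.
      apply: (le_trans (I_le _ _ As)); apply: (le_trans (sD _ _)).
      by have := ts y; lra.
    rewrite le_eqVlt => /predU1P[<-|a0].
      have [sq0 _] := svalP q0.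
      by have := I_le _ 0 Aq0; rewrite scale0r mul0r (sublinear0 sq0).
    rewrite -ler_pdivrMl//; apply: (le_I) => s As.
    have [[_ sZ] _] := svalP s.
    by rewrite ler_pdivrMl//; apply: (le_trans (I_le _ _ As)); exact/sZ/ltW.
  have Ip x : I x <= p x.
    by apply: (le_trans (I_le _ _ Aq0)); have [_] := svalP q0.
  by exists (exist _ I (conj sI Ip)) => s As; apply/asboolP => x; exact: I_le.
- exists q; split => // q' sq' q'q.
  have q'p x : q' x <= p x by apply: le_trans (qp x).
  by have /asboolP := qmax (exist _ q' (conj sq' q'p)) (asboolT q'q).
Qed.

Lemma hahn_banach p v : sublinear p ->
  exists f : V -> R, [/\ linear (f : V -> R^o), forall x, f x <= p x & f v = p v].
Proof.
move=> sp; have sp1 := shift_sublinear v sp.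
have [q [sq qp1 qmin]] := minimal_sublinear sp1.
have qp x : q x <= p x by apply: le_trans (qp1 x) (shift_le_id v x sp).
have [qD qZ] := sq.
have qD' x y : q (x + y) = q x + q y.
  apply/eqP; rewrite eq_le qD/=.
  (* Minimality against [shift q x] gives [q y <= shift q x y <= q (y + x) - q x]. *)
  have := qmin _ (shift_sublinear x sq) (fun y => shift_le_id x y sq) y.
  have := shift_le x y sq ler01; rewrite scale1r mul1r (addrC y x); lra.
have qN x : q (- x) = - q x.
  by have := qD' x (- x); rewrite subrr sublinear0//; lra.
have qZ' a x : q (a *: x) = a * q x.
  have [a0|a0] := leP 0 a; first exact: sublinear_pos.
  by rewrite -[a]opprK scaleNr qN sublinear_pos ?mulNr// oppr_ge0 ltW.
exists q; split => [a x y|//|]; first by rewrite qD' qZ'.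
apply/eqP; rewrite eq_le qp/= -lerN2 -qN.
(* The parameter [1] gives [q (- v) <= shift p v (- v) <= p (- v + v) - p v = - p v]. *)
apply: (le_trans (qp1 _)); have := shift_le v (- v) sp ler01.
by rewrite scale1r mul1r addNr sublinear0// sub0r.
Qed.

End HahnBanach.

(** * Real and complex scalars *)

Definition norming_functionals (K : numFieldType) :=
  forall (X : normedModType K) (v : X), exists f : X -> K^o,
    [/\ linear f, forall x, `|f x| <= `|x| & `|f v| = `|v|].

(** The form in which compactness of the unit circle of scalars is used: a bound that is almost
    reached is reached. *)
Definition circle_attained (K : numFieldType) :=
  forall (X : normedModType K) (x y : X) (b : K),
    (forall e : K, 0 < e -> exists2 t : K, `|t| = 1 & b - e <= `|x + t *: y|) ->
    exists2 t : K, `|t| = 1 & b <= `|x + t *: y|.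

(** The Archimedean property, which a general [numFieldType] may fail. *)
Definition small_inverses (K : numFieldType) :=
  forall e : K, 0 < e -> exists n : nat, n.+1%:R^-1 < e.

(** * Norming functionals and the unit circle for real scalars *)

Section Real.
Context {R : realType}.

Lemma real_small_inverses : small_inverses R.
Proof.
move=> e e0; have [n _ nP] := near_infty_natSinv_lt (PosNum e0).
by exists n; exact: nP (leqnn n).
Qed.

Lemma real_norming_functionals : norming_functionals R.
Proof.
move=> X v; have sp : sublinear (fun x : X => `|x|).
  split=> [x y|a x a0]; first exact: ler_normD.
  by rewrite normrZ ger0_norm.
have [f [lf fle fv]] := hahn_banach v sp.
pose F := HB.pack_for {linear X -> R^o} f (GRing.isLinear.Build _ _ _ _ _ lf).
exists f; split => // [x|]; last by rewrite fv normr_id.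
rewrite ler_norml fle andbT lerNl.
by rewrite -(linearN F) -normrN; exact: fle.
Qed.

Lemma real_circle_attained : circle_attained R.
Proof.
move=> X x y b H.
have [b1|b1] := leP b `|x + 1 *: y|; first by exists 1 => //; rewrite normr1.
have [b2|b2] := leP b `|x + -1 *: y|; first by exists (-1) => //; rewrite normrN1.
(* Half the smaller deficit: with it neither sign can reach [b - e]. *)
pose e := Num.min (b - `|x + 1 *: y|) (b - `|x + -1 *: y|) / 2.
have m0 : 0 < Num.min (b - `|x + 1 *: y|) (b - `|x + -1 *: y|).
  by rewrite lt_min !subr_gt0 b1.
have [|t t1] := H e; first by rewrite divr_gt0.
have e1 : e < b - `|x + 1 *: y|.
  have : 2 * e <= b - `|x + 1 *: y| by rewrite /e mulrC divfK// ge_min lexx.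
  by have : 0 < e by [rewrite divr_gt0]; lra.
have e2 : e < b - `|x + -1 *: y|.
  have : 2 * e <= b - `|x + -1 *: y| by rewrite /e mulrC divfK// ge_min lexx orbT.
  by have : 0 < e by [rewrite divr_gt0]; lra.
have [t0|t0] := leP 0 t; move: t1.
  by rewrite ger0_norm// => ->; lra.
by rewrite ltr0_norm// => /(canRL (@opprK _)) ->; lra.
Qed.

End Real.

(** A second name for the same group carries the real scalar action, keeping it apart from the
    complex one. *)
Definition realification (R : realType) (X : lmodType R[i]) : Type := X.

Section Realification.
Context {R : realType} (X : lmodType R[i]).

Let scale (a : R) (x : realification X) : realification X := a%:C%C *: (x : X).

Let scaleA a b v : scale a (scale b v) = scale (a * b) v.
Proof. by rewrite /scale scalerA rmorphM. Qed.

Let scale1 : left_id 1 scale.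
Proof. by move=> v; rewrite /scale rmorph1 scale1r. Qed.

Let scaleDr : right_distributive scale +%R.
Proof. by move=> a u v; rewrite /scale scalerDr. Qed.

Let scaleDl v : {morph scale^~ v : a b / a + b}.
Proof. by move=> a b; rewrite /scale rmorphD scalerDl. Qed.

HB.instance Definition _ := GRing.Zmodule.on (realification X).
HB.instance Definition _ := GRing.Zmodule_isLmodule.Build R (realification X)
  scaleA scale1 scaleDr scaleDl.

Lemma realificationE (a : R) (x : realification X) :
  a *: x = a%:C%C *: (x : X) :> X.
Proof. by []. Qed.

End Realification.

(** * Norming functionals and the unit circle for complex scalars *)

Section Complex.
Context {R : realType}.
Local Open Scope complex_scope.
Local Notation Re := complex.Re.
Local Notation Im := complex.Im.

Lemma complex_small_inverses : small_inverses R[i].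
Proof.
move=> e e0; have re : e = (Re e)%:C by rewrite RRe_real// gtr0_real.
have /real_small_inverses [n ne] : 0 < Re e by rewrite -ltcR -re.
by exists n; rewrite re -[n.+1%:R](rmorph_nat (real_complex R)) -fmorphV ltcR.
Qed.

Lemma norm_Re (X : normedModType R[i]) (x : X) : (Re `|x|)%:C = `|x|.
Proof. by rewrite RRe_real. Qed.

Lemma normcR (a : R) : `|a%:C| = `|a|%:C :> R[i].
Proof. by rewrite normc_def /= expr0n addr0 sqrtr_sqr. Qed.

(** A real functional [g] norming [v] is the real part of the complex linear map sending [x] to
    [g x - i g (i x)]. *)
Lemma complex_norming_functionals : norming_functionals R[i].
Proof.
move=> X v; pose p (x : realification X) : R := Re `|x : X|.
have sp : sublinear p.
  split=> [x y|a x a0]; rewrite -lecR.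
    rewrite rmorphD /= !norm_Re; exact: (@ler_normD _ X (x : X) (y : X)).
  by rewrite rmorphM /= !norm_Re realificationE normrZ ger0_norm// ler0c.
have [g [lg gp gv]] := hahn_banach (v : realification X) sp.
have gD (x y : X) : g (x + y : X) = g x + g y.
  by have := lg 1 x y; rewrite !scale1r.
have g0 : g (0 : X) = 0 by have := gD 0 0; rewrite addr0; lra.
have gZ (a : R) (x : X) : g (a%:C *: x : X) = a * g x.
  rewrite -[RHS]addr0 -[X in _ = _ + X]g0; apply: etrans (lg a x (0 : X)).
  by congr g; symmetry; exact: (@addr0 X).
pose f (x : X) : R[i]^o := g x +i* - g ('i *: x : X).
have lf : linear f.
  move=> [a b] x y; rewrite /f.
  have e1 : g ((a +i* b) *: x + y : X) = a * g x + b * g ('i *: x : X) + g y.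
    rewrite gD; congr (_ + _); rewrite -!gZ -gD; congr (g _).
    by rewrite !scalerA -scalerDl; apply: (congr1 (fun k => k *: x)); simpc.
  have e2 : g ('i *: ((a +i* b) *: x + y) : X) =
      a * g ('i *: x : X) - b * g x + g ('i *: y : X).
    rewrite scalerDr gD; congr (_ + _).
    rewrite -mulNr -!gZ -gD; congr (g _).
    by rewrite !scalerA -scalerDl; apply: (congr1 (fun k => k *: x)); simpc.
  rewrite e1 e2; simpc; congr (_ +i* _); ring.
pose F := HB.pack_for {linear X -> R[i]^o} f (GRing.isLinear.Build _ _ _ _ _ lf).
have fZ a (u : X) : f (a *: u) = a * f u by exact: (linearZ_LR F a u).
have fle x : `|f x| <= `|x|.
  have [f0|f0] := eqVneq (f x) 0; first by rewrite f0 normr0.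
  have fn0 : `|f x| != 0 by rewrite normr_eq0.
  (* Rotating [x] by [t] makes the value of [f] a nonnegative real, hence equal to that of [g],
     which the norm dominates. *)
  set t : R[i] := `|f x| / f x.
  have ft : f (t *: x) = `|f x| by rewrite fZ /t -mulrA mulVf// mulr1.
  have t1 : `|t| = 1 by rewrite normrM normfV normr_id mulfV.
  rewrite -ft -[`|x|]mul1r -t1 -normrZ.
  have -> : f (t *: x) = (g (t *: x : X))%:C.
    have : f (t *: x) \is Num.real by rewrite ft normr_real.
    by move=> /RRe_real <-.
  by rewrite -[leRHS]norm_Re lecR; exact: gp.
exists f; split => //; apply/eqP; rewrite eq_le fle/=.
apply: le_trans (normc_ge_Re _); rewrite /= gv -[leLHS]norm_Re lecR.
exact: ler_norm.
Qed.

(** The circle is viewed in the real plane, where the extreme value theorem applies to the real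
    function [N]. *)
Lemma complex_circle_attained : circle_attained R[i].
Proof.
move=> X x y b H.
pose circle := [set z : R * R | z.1 ^+ 2 + z.2 ^+ 2 = 1].
pose N (z : R * R) : R := Re `|x + (z.1 +i* z.2) *: y|.
have norm_circle z : circle z -> `|z.1 +i* z.2| = 1 :> R[i].
  by rewrite /circle/= normc_def /= => ->; rewrite sqrtr1.
have circle_norm (t : R[i]) : `|t| = 1 -> circle (Re t, Im t).
  move=> t1; rewrite /circle /=; apply: complexI.
  by rewrite add_Re2_Im2 t1 expr1n.
have cN : continuous N.
  move=> z; apply/cvgrPdist_le => e e0.
  (* The two coordinates together cost at most [2 * d] times the norm of [y]; the [+ 1] keeps the
     denominator positive when [y = 0]. *)
  pose d := e / (2 * (Re `|y| + 1)).
  have y0 : 0 <= Re `|y| by rewrite -ler0c norm_Re.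
  have d0 : 0 < d by rewrite divr_gt0// mulr_gt0//; lra.
  exists (ball z.1 d, ball z.2 d) => /=; first by split; exact: nbhsx_ballx.
  move=> w [/= /ltW w1 /ltW w2].
  have dz : `|(z.1 +i* z.2) - (w.1 +i* w.2)| <= (2 * d)%:C.
    have -> : (z.1 +i* z.2) - (w.1 +i* w.2) =
        (z.1 - w.1)%:C + 'i * (z.2 - w.2)%:C by simpc.
    apply: (le_trans (ler_normD _ _)).
    have i1 : `|'i : R[i]| = 1 by rewrite normc_def /= expr0n expr1n add0r sqrtr1.
    rewrite normrM i1 mul1r !normcR -rmorphD /= lecR mulr2n mulrDl !mul1r.
    exact: lerD.
  have main : `|N z - N w| <= 2 * d * Re `|y|.
    rewrite -lecR.
    have -> : `|N z - N w|%:C = `| (N z)%:C - (N w)%:C|.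
      by rewrite -rmorphB /= normcR.
    rewrite !norm_Re rmorphM /= norm_Re.
    apply: (le_trans (ler_dist_dist _ _)).
    by rewrite opprD addrACA subrr add0r -scalerBl normrZ ler_wpM2r.
  apply: (le_trans main); rewrite /d.
  have -> : 2 * (e / (2 * (Re `|y| + 1))) * Re `|y| = e * (Re `|y| / (Re `|y| + 1)).
    by field; lra.
  by rewrite ler_piMr ?(ltW e0)// ler_pdivrMr; lra.
have cc : compact circle.
  apply: (@subclosed_compact _ _ (`[-1, 1]%classic `*` `[-1, 1]%classic : set (R * R))).
  - have -> : circle = (fun z : R * R => z.1 * z.1 + z.2 * z.2) @^-1` [set 1].
      by apply/seteqP; split => z; rewrite /circle /= !expr2.
    apply: preimage_closed => [z _|]; last exact: closed_eq.
    by apply: cvgD; apply: cvgM; (exact: cvg_fst || exact: cvg_snd).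
  - by apply: compact_setX; exact: segment_compact.
  - by move=> z; rewrite /circle /= !in_itv /= => ?; split; apply/andP; split; nra.
have [||z zc zmax] := @compact_EVT_max _ _ N circle _ cc.
- by exists (1, 0); rewrite /circle/= expr1n expr0n addr0.
- exact: continuous_subspaceT.
exists (z.1 +i* z.2); first exact/norm_circle/set_mem.
apply/ler_addgt0Pr => e e0; have [t t1] := H e e0.
rewrite lerBlDr => /le_trans; apply; rewrite lerD2r.
rewrite -[leRHS]norm_Re -[leLHS]norm_Re lecR.
have := zmax (Re t, Im t) (mem_set (circle_norm t t1)).
by rewrite /N /=; case: (t).
Qed.

End Complex.

(** * Weak neighbourhoods *)

Lemma norm_le_closed (K : numFieldType) (V : normedModType K) (e : K) :
  closed [set v : V | `|v| <= e].
Proof.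
move=> z clz; apply/ler_addgt0Pr => d d0.
have [w [/= we]] := clz _ (nbhsx_ballx z d d0).
rewrite -ball_normE /= => /ltW zw.
by rewrite -(subrK w z) addrC (le_trans (ler_normD _ _))// lerD.
Qed.

Section WeakTopology.
Context {K : numFieldType} {X : completeNormedModType K}.
Implicit Types (s : seq (X -> K^o)) (f : X -> K^o) (x y z c : X) (e : K).

Definition duals s := forall f, List.In f s -> dual f.

Definition weak_ball s x e : set X :=
  [set z | forall f, List.In f s -> `|f (z - x)| < e].

Definition weak_closed_ball s x e : set X :=
  [set z | forall f, List.In f s -> `|f (z - x)| <= e].

Lemma dualB f x y : dual f -> f (x - y) = f x - f y.
Proof.
move=> [lf _].
pose F := HB.pack_for {linear X -> K^o} f (GRing.isLinear.Build _ _ _ _ _ lf).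
exact: (linearB F).
Qed.

Lemma dualD f x y : dual f -> f (x + y) = f x + f y.
Proof. by move=> [lf _]; have := lf 1 x y; rewrite !scale1r. Qed.

Lemma dual0 f : dual f -> f 0 = 0.
Proof. by move=> df; rewrite -(subrr 0) dualB// subrr. Qed.

Lemma dualZ f a x : dual f -> f (a *: x) = a * f x.
Proof.
by move=> df; have [lf _] := df; have := lf a x 0; rewrite addr0 dual0// addr0.
Qed.

Lemma weak_ball_center s x e : duals s -> 0 < e -> weak_ball s x e x.
Proof. by move=> ds e0 f /ds df; rewrite subrr dual0// normr0. Qed.

Lemma dual_weakly_continuous f : dual f ->
  continuous (f : weak X -> K^o).
Proof.
move=> df x.
have /cvg_sup/(_ (SigSub (mem_set df))) := @cvg_id _ (nbhs (x : weak X)).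
move=> H; apply: cvg_trans (@initial_continuous X K^o f x).
exact: cvg_app H.
Qed.

Lemma weak_ball_open s x e : duals s -> @open (weak X) (weak_ball s x e).
Proof.
elim: s => [_|f s IH ds].
  have -> : weak_ball [::] x e = setT by apply/seteqP; split => // z _ f [].
  exact: openT.
have -> : weak_ball (f :: s) x e =
    (fun z => `|f z - f x|) @^-1` [set r | r < e] `&` weak_ball s x e.
  apply/seteqP; split => [z H|z [H1 H2] g].
    split; first by rewrite /= -dualB; [exact: H (or_introl _)|exact: ds (or_introl _)].
    by move=> g gs; apply: H; right.
  by case=> [<-|]; [rewrite dualB//; exact: ds (or_introl _)|exact: H2].
apply: openI; last by apply: IH => g gs; apply: ds; right.
rewrite openE => z /= ze.
have cf := @dual_weakly_continuous f (ds _ (or_introl erefl)) z.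
apply: (cf [set w | `|w - f x| < e]).
apply/nbhs_ballP; exists (e - `|f z - f x|); first by rewrite /= subr_gt0.
move=> w /= zw; rewrite -(subrKA (f z)) (le_lt_trans (ler_normD _ _))//.
by rewrite distrC -ltrBrDr.
Qed.

Lemma weak_ball_nbhs s x e : duals s -> 0 < e ->
  nbhs (x : weak X) (weak_ball s x e).
Proof.
move=> ds e0; apply: open_nbhs_nbhs; split; first exact: weak_ball_open.
exact: weak_ball_center.
Qed.

(** The weak balls at [x] generate a filter. It converges to [x] in the initial topology of each
    functional, hence in their supremum. *)
Lemma weak_ball_basis x (U : set (weak X)) : nbhs (x : weak X) U ->
  exists s e, [/\ duals s, 0 < e & weak_ball s x e `<=` U].
Proof.
pose D := [set p : seq (X -> K^o) * K | duals p.1 /\ 0 < p.2].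
pose F := filter_from D (fun p => weak_ball p.1 x p.2).
have FF : Filter F.
  apply: filter_from_filter; first by exists ([::], 1); split => //= f [].
  move=> [s e] [s' e'] [/= ds e0] [/= ds' e0'].
  exists (s ++ s', Num.min e e'); first split => /=.
  - by move=> f /List.in_app_iff[/ds|/ds'].
  (* The order of [K] may be partial; positive elements are real, so they can be compared. *)
  - by rewrite comparable_lt_min ?e0// real_comparable// gtr0_real.
  - have cmp : e >=< e' by rewrite real_comparable// gtr0_real.
    move=> z H; split => f fs.
      have : `|f (z - x)| < Num.min e e' by apply: H; apply/List.in_app_iff; left.
      by rewrite comparable_lt_min// => /andP[].
    have : `|f (z - x)| < Num.min e e' by apply: H; apply/List.in_app_iff; right.
    by rewrite comparable_lt_min// => /andP[].
have Fx : F --> (x : weak X).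
  apply/cvg_sup => -[f df'] U' [_ [[B oB <-] Bfx sBU]].
  have df : dual f := set_mem df'.
  have /nbhs_ballP [e /= e0 eB] : nbhs (f x) B by exact: open_nbhs_nbhs.
  exists ([:: f], e); first by split => // g [<-|].
  move=> z /(_ f (or_introl erefl)) zx; apply: sBU; apply: eB.
  by rewrite /ball /= distrC -dualB.
by move=> /Fx [[s e] [ds e0] sU]; exists s, e.
Qed.

Lemma weak_closed_ball_closed s x e : duals s -> closed (weak_closed_ball s x e).
Proof.
move=> ds.
have -> : weak_closed_ball s x e = \bigcap_(f in [set f | List.In f s])
   (fun z => f z - f x) @^-1` [set r : K^o | `|r| <= e].
  apply/seteqP; split => z H f /= fs; have := H f fs; rewrite /= dualB//; exact: ds.
apply: closed_bigI => f /= fs; have [_ cf] := ds _ fs.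
apply: preimage_closed => [z _|]; first by apply: cvgB; [exact: cf|exact: cvg_cst].
exact: norm_le_closed.
Qed.

End WeakTopology.

(** * Points of continuity of the unit ball *)

Section PointsOfContinuity.
Context {K : numFieldType} {X : completeNormedModType K}.
Implicit Types (s : seq (X -> K^o)) (x y z c : X).
Local Notation B := (unit_ball X).

Lemma PC_weak_ball (A : set X) y (d : K) : PC A y -> 0 < d ->
  exists s e, [/\ duals s, 0 < e &
    forall z, weak_ball s y e z -> A z -> `|y - z| < d].
Proof.
move=> [Ay cy] d0.
have : within A (nbhs (y : weak X)) (ball y d) by apply: cy; exact: nbhsx_ballx.
rewrite /within /= => /weak_ball_basis [s [e [ds e0 H]]].
by exists s, e; split => // z /H; rewrite -ball_normE.
Qed.

(** The common kernel has finite codimension. A new functional either vanishes on the previous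
    kernel or costs one more vector [k] of it. *)
Lemma common_kernel_decomposition s : duals s ->
  exists (n : nat) (b : 'I_n -> X), forall x, exists c : 'I_n -> K,
    forall f, List.In f s -> f (x - \sum_(i < n) c i *: b i) = 0.
Proof.
elim: s => [_|f s IH ds].
  by exists 0%N, (fun=> 0) => x; exists (fun=> 0) => f [].
have dss : duals s by move=> g gs; apply: ds; right.
have df : dual f by apply: ds; left.
have [n [b Hb]] := IH dss.
have [fker|] := pselect (forall k, (forall g, List.In g s -> g k = 0) -> f k = 0).
  exists n, b => x; have [c Hc] := Hb x; exists c => g [<-|]; last exact: Hc.
  exact: fker.
move=> /existsNP [k] /not_implyP [ks] /eqP fk.
(* Index [0] carries [k], with coefficient [f r / f k] cancelling [f] on the remainder [r]; the
   other indices carry the old vectors. *)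
exists n.+1, (fun i => oapp b k (unlift ord0 i)) => x; have [c Hc] := Hb x.
set r := x - _ in Hc.
exists (fun i => oapp c (f r / f k) (unlift ord0 i)) => g gs.
have dg : dual g by exact: ds.
rewrite big_ord_recl unlift_none /=.
under eq_bigr do rewrite liftK /=.
rewrite opprD addrCA addrC -/r dualB// dualZ//.
case: gs => [<-|gs]; first by rewrite divfK// subrr.
by rewrite (Hc _ gs) (ks _ gs) mulr0 subr0.
Qed.

Lemma common_kernel_nontrivial s : infinite_dimensional X -> duals s ->
  exists2 v : X, v != 0 & forall f, List.In f s -> f v = 0.
Proof.
move=> infX ds; apply: contrapT => H; apply: infX.
have [n [b Hb]] := common_kernel_decomposition ds.
exists n, b => x; have [c Hc] := Hb x; exists c.
apply/eqP; rewrite -subr_eq0; apply: contrapT => /negP v0.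
by apply: H; exists (x - \sum_(i < n) c i *: b i).
Qed.

(** If [y] were interior, moving it by exactly [1 - |y|] along a common kernel direction would stay
    in the ball and in the weak neighbourhood, yet not get closer than [1 - |y|]. *)
Lemma PC_unit_ball_sphere y : infinite_dimensional X -> PC B y -> `|y| = 1.
Proof.
move=> infX PCy; have [yB _] := PCy; apply/eqP; rewrite eq_le yB/=.
rewrite real_leNgt//; apply/negP => y1.
have d0 : 0 < 1 - `|y| by rewrite subr_gt0.
have [s [e [ds e0 Hs]]] := PC_weak_ball PCy d0.
have [v v0 Hv] := common_kernel_nontrivial infX ds.
pose t := (1 - `|y|) / `|v|.
have tv : `|t *: v| = 1 - `|y|.
  by rewrite normrZ normf_div normr_id divfK ?normr_eq0// gtr0_norm.
have : `|y - (y + t *: v)| < 1 - `|y|.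
  apply: Hs => [f fs|].
    by rewrite addrAC subrr add0r dualZ ?Hv ?mulr0 ?normr0//; exact: ds.
  by rewrite /unit_ball /= (le_trans (ler_normD _ _))// tv subrKC.
by rewrite opprD addrA subrr sub0r normrN tv ltxx.
Qed.

Lemma dual_of_contraction (f : X -> K^o) : linear f ->
  (forall x, `|f x| <= `|x|) -> dual f.
Proof.
move=> lf fle; split => //.
pose F := HB.pack_for {linear X -> K^o} f (GRing.isLinear.Build _ _ _ _ _ lf).
move=> x; apply/cvgrPdist_lt => e e0; near=> y.
rewrite -(linearB F) (le_lt_trans (fle _))//.
Unshelve. all: by end_near.
Qed.

Lemma dual_sphere_of_contraction (f : X -> K^o) x : linear f ->
  (forall x, `|f x| <= `|x|) -> `|x| <= 1 -> `|f x| = 1 -> dual_sphere f.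
Proof.
move=> lf fle x1 fx; split; first exact: dual_of_contraction.
split=> [_ [y /= yB <-]|b]; first exact: le_trans yB.
by apply; exists x.
Qed.

Lemma super_AD_PC x y : circle_attained K -> super_AD x -> PC B y -> `|y| = 1 ->
  exists2 t : K, `|t| = 1 & 2 <= `|x + t *: y|.
Proof.
move=> circ [_ AD] PCy y1; apply: circ => e e0.
have e20 : 0 < e / 2 by rewrite divr_gt0.
have [s [d [ds d0 Hs]]] := PC_weak_ball PCy e20.
pose W := weak_ball s y d `&` B.
have Wy : W y by split; [exact: weak_ball_center|rewrite /unit_ball /= y1].
have [|||_ lub] := AD W.
- by exists y.
- by exists (weak_ball s y d) => //; exact: weak_ball_open.
- by exists y.
apply: contrapT => H.
(* If no [t] satisfies the bound for [e], then [2 - e / 2] bounds all the maxima over [W], because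
   points of [W] are within [e / 2] of [y]. *)
suff : 2 <= 2 - e / 2 :> K by rewrite lerBrDr gerDl => /(lt_le_trans e20); rewrite ltxx.
apply: lub => m [z [zy zB] [[t /= t1 <-] _]].
have re : 2 - e / 2 \is Num.real by rewrite rpredB// gtr0_real.
apply: contrapT => /negP; rewrite -real_ltNge// => /ltW lt_m; apply: H.
exists t => //.
have -> : 2 - e = 2 - e / 2 - e / 2 by rewrite {1}(splitr e) opprD addrA.
rewrite lerBlDr (le_trans lt_m)//.
have -> : x + t *: z = x + t *: y + t *: (z - y).
  by rewrite scalerBr addrA addrAC addrK.
apply: (le_trans (ler_normD _ _)); rewrite lerD2l normrZ t1 mul1r distrC.
exact/ltW/Hs.
Qed.

Lemma gateaux_not_super_AD x : norming_functionals K -> circle_attained K ->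
  infinite_dimensional X -> weakly_dense_in (PC B) B ->
  gateaux_point x -> ~ super_AD x.
Proof.
move=> norming circ infX [_ dense] [x1 [fx [[[dfx _] _] fx_unique]]] AD.
have dfx1 : duals [:: fx] by move=> f [<-|].
have B0 : B 0 by rewrite /unit_ball /= normr0.
(* Density near [0] yields a point of continuity [y] with [|fx y| < 1]. *)
have [y [PCy y0]] := dense 0 B0 _ (weak_ball_nbhs 0 dfx1 ltr01).
have y1 := PC_unit_ball_sphere infX PCy.
have [t t1 le2] := super_AD_PC circ AD PCy y1.
have [f [lf fle fv]] := norming X (x + t *: y).
have df := dual_of_contraction lf fle.
have fx1 : `|f x| <= 1 by rewrite -x1; exact: fle.
have fy1 : `|f y| <= 1 by rewrite -y1; exact: fle.
have sum2 : 2 <= `|f x| + `|f y|.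
  rewrite (le_trans le2)// -fv dualD// dualZ// (le_trans (ler_normD _ _))//.
  by rewrite normrM t1 mul1r.
have fx_eq1 : `|f x| = 1.
  apply/eqP; rewrite eq_le fx1/= -(lerD2r 1) (le_trans sum2)//.
  by rewrite lerD2l.
have fy_eq1 : `|f y| = 1.
  apply/eqP; rewrite eq_le fy1/= -(lerD2l 1) (le_trans sum2)//.
  by rewrite lerD2r.
have fx_neq0 : f x != 0 by rewrite -normr_eq0 fx_eq1 oner_eq0.
have nfxV : `|(f x)^-1| = 1 by rewrite normfV fx_eq1 invr1.
(* Dividing by the unimodular [f x] gives a norm-one functional equal to [1] at [x], so uniqueness
   identifies it with [fx]. *)
pose g : X -> K^o := fun z => (f x)^-1 * f z.
have lg : linear g.
  by move=> a u v; rewrite /g lf mulrDr [_ * (a *: _)]mulrCA.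
have gle z : `|g z| <= `|z| by rewrite normrM nfxV mul1r.
have gx1 : g x = 1 by rewrite /g mulVf.
have gS : dual_sphere g.
  by apply: (dual_sphere_of_contraction lg gle (x := x)); rewrite ?x1// gx1 normr1.
have := y0 fx (or_introl erefl).
rewrite subr0 (fx_unique _ (conj gS gx1)) /g normrM nfxV fy_eq1 mulr1 ltxx//.
Qed.

End PointsOfContinuity.

(** * Density of the points of continuity *)

Section Density.
Context {K : numFieldType} {X : completeNormedModType K}.
Implicit Types (s : seq (X -> K^o)) (x y z c : X).
Local Notation B := (unit_ball X).

(** The bound is [1] plus the sum of the moduli, which is positive and needs no maximum in [K]. *)
Lemma duals_bounded s y : exists2 M : K, 0 < M &
  forall f, List.In f s -> `|f y| <= M.
Proof.
elim: s => [|f s [M M0 HM]]; first by exists 1 => // f [].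
exists (M + `|f y|) => [|g [<-|/HM gM]]; first by rewrite ltr_wpDr.
  by rewrite lerDr ltW.
by rewrite (le_trans gM)// lerDl.
Qed.

Definition weak_slab s c (e : K) : set X := B `&` weak_closed_ball s c e.

Lemma weak_slab_closed s c e : duals s -> closed (weak_slab s c e).
Proof.
by move=> ds; apply: closedI; [exact: norm_le_closed|exact: weak_closed_ball_closed].
Qed.

Lemma weak_slab_bounded s c e : bounded_set (weak_slab s c e).
Proof.
exists 1; split => // M M1 x [xB _]; exact: (le_trans xB (ltW M1)).
Qed.

Lemma weak_slab_convex s c e : duals s -> convex_set (weak_slab s c e).
Proof.
move=> ds x y t; rewrite !inE => -[xB xs] [yB ys].
have t0 : 0 <= t%:num by [].
have t1 : 0 <= 1 - t%:num by rewrite subr_ge0.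
have convE : conv t x y = t%:num *: (x : X) + (1 - t%:num) *: (y : X) :> X by [].
have step (p q r : K) : p <= r -> q <= r -> t%:num * p + (1 - t%:num) * q <= r.
  move=> pr qr; rewrite -[leRHS]mul1r -[X in X * r](subrKC t%:num) [leRHS]mulrDl.
  by rewrite lerD// ler_wpM2l.
split=> [|f fs].
  rewrite /unit_ball /= convE (le_trans (ler_normD _ _))// !normrZ !ger0_norm//.
  exact: step.
have df := ds _ fs.
rewrite convE dualB// dualD// !dualZ//.
have -> : t%:num * f x + (1 - t%:num) * f y - f c =
    t%:num * f (x - c) + (1 - t%:num) * f (y - c) by rewrite !dualB//; ring.
rewrite (le_trans (ler_normD _ _))// !normrM (ger0_norm t0) (ger0_norm t1).
by apply: step; [exact: xs|exact: ys].
Qed.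

(* A point of continuity of the slab of half-width [e / 2] may lie on the
   boundary of the slab; moving it slightly towards the center [c] reaches a
   point near which the slab and the ball have the same weak neighbourhoods. *)
Lemma small_weak_ball s c (e d : K) : CPCP X -> duals s -> 0 < e -> B c -> 0 < d ->
  exists s' c' e', [/\ duals s', 0 < e', B c' &
    forall z, B z -> weak_ball s' c' e' z ->
      weak_ball s c (e / 2) z /\ `|c' - z| < d].
Proof.
move=> cpcp ds e0 cB d0.
have e2 : 0 < e / 2 by rewrite divr_gt0.
have d2 : 0 < d / 2 by rewrite divr_gt0.
have [||||y PCy] := cpcp (weak_slab s c (e / 2)).
- by exists c; split => // f fs; exact/ltW/(weak_ball_center c ds e2).
- exact: weak_slab_closed.
- exact: weak_slab_convex.
- exact: weak_slab_bounded.
have [[yB ys] _] := PCy.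
have [s1 [e1 [ds1 e10 H1]]] := PC_weak_ball PCy d2.
have [M M0 HM] := duals_bounded s1 (c - y).
have Me0 : 0 < M + e1 by rewrite addr_gt0.
have [t [t0 t1 tM]] : exists t, [/\ 0 < t, t < 1 & t * M < e1].
  (* This single ratio is below [1] and satisfies [t * M < e1]. *)
  exists (e1 / (M + e1)); split; first by rewrite divr_gt0.
    by rewrite ltr_pdivrMr// mul1r ltrDr.
  by rewrite mulrAC ltr_pdivrMr// ltr_pM2l// ltrDl.
have t1' : 0 < 1 - t by rewrite subr_gt0.
pose c' := y + t *: (c - y).
have c'E : c' = (1 - t) *: y + t *: c.
  by rewrite /c' scalerBr scalerBl scale1r addrA addrAC.
have c'1 : weak_ball s1 y e1 c'.
  move=> f fs; rewrite /c' addrAC subrr add0r dualZ; last exact: ds1.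
  by rewrite normrM gtr0_norm// (le_lt_trans (ler_wpM2l (ltW t0) (HM _ fs)))//.
have c'2 : weak_ball s c (e / 2) c'.
  move=> f fs.
  have -> : c' - c = (1 - t) *: (y - c).
    by rewrite scalerBr c'E -addrA (scalerBl 1 t c) scale1r opprB.
  rewrite dualZ; last exact: ds.
  rewrite normrM (gtr0_norm t1').
  apply: (le_lt_trans (ler_wpM2l (ltW t1') (ys _ fs))).
  (* The factor [1 - t] turns the non-strict slab inequality into a strict one. *)
  by rewrite gtr_pMl// ltrBlDr ltrDl.
have c'B : B c'.
  rewrite /unit_ball /= c'E (le_trans (ler_normD _ _))// !normrZ.
  rewrite (gtr0_norm t1') (gtr0_norm t0) -[leRHS](subrK t).
  by rewrite lerD// ler_piMr// ltW.
have : nbhs (c' : weak X) (weak_ball s1 y e1 `&` weak_ball s c (e / 2)).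
  apply: open_nbhs_nbhs; split; last by split.
  by apply: openI; exact: weak_ball_open.
move=> /weak_ball_basis [s' [e' [ds' e'0 H']]].
exists s', c', e'; split => // z zB /H' [z1 z2]; split => //.
have close w : B w -> weak_ball s1 y e1 w -> weak_ball s c (e / 2) w ->
    `|y - w| < d / 2.
  by move=> wB w1 w2; apply: H1 => //; split => // f fs; exact/ltW/w2.
rewrite -(subrKA y) (le_lt_trans (ler_normD _ _))// (splitr d) ltrD//.
  by rewrite distrC; exact: close.
exact: close.
Qed.

(** A weak ball centred in [B], bundled with its proofs so that dependent choice can iterate over
    such balls. *)
Record weak_datum := WeakDatum {
  wd_seq : seq (X -> K^o);
  wd_center : X;
  wd_radius : K;
  wd_duals : duals wd_seq;
  wd_radius_gt0 : 0 < wd_radius;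
  wd_centerB : B wd_center }.

Definition wd_ball (w : weak_datum) :=
  weak_ball (wd_seq w) (wd_center w) (wd_radius w).

Lemma CPCP_weakly_dense : small_inverses K -> CPCP X ->
  weakly_dense_in (PC B) B.
Proof.
move=> small cpcp; split=> [x [//]|x xB U /weak_ball_basis [s [e [ds e0 sU]]]].
(* The natural number counts the stages and sets the norm bound. Halving the radius leaves room for
   limits to stay in the open weak ball. *)
pose next (p q : nat * weak_datum) := q.1 = p.1.+1 /\
  forall z, B z -> wd_ball q.2 z ->
    weak_ball (wd_seq p.2) (wd_center p.2) (wd_radius p.2 / 2) z /\
    `|wd_center q.2 - z| < p.1.+1%:R^-1.
have step p : {q | next p q}.
  apply: cid; case: p => n [s0 c0 e1 ds0 e10 c0B].
  have n0 : 0 < n.+1%:R^-1 :> K by rewrite invr_gt0.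
  have [s' [c' [e' [ds' e'0 c'B H]]]] := small_weak_ball cpcp ds0 e10 c0B n0.
  by exists (n.+1, WeakDatum ds' e'0 c'B).
have [u [u0 uS]] := dependent_choice step (0%N, WeakDatum ds e0 xB).
have un n : (u n).1 = n by elim: n => [|n IH]; [rewrite u0|rewrite (uS n).1 IH].
pose w n := (u n).2; pose a n := wd_center (w n).
have wS n z : B z -> wd_ball (w n.+1) z ->
    weak_ball (wd_seq (w n)) (a n) (wd_radius (w n) / 2) z /\
    `|a n.+1 - z| < n.+1%:R^-1.
  by move=> zB zn; have := (uS n).2 z zB zn; rewrite un.
have aB n : B (a n) by exact: wd_centerB.
have wdec n m z : B z -> wd_ball (w (n + m)%N) z -> wd_ball (w n) z.
  move=> zB; elim: m => [|m IH]; first by rewrite addn0.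
  rewrite addnS => /wS-/(_ zB)[H _]; apply: IH => f fs.
  apply: lt_le_trans (H f fs) _.
  by rewrite ler_pdivrMr// ler_peMr// ?ler1n// ltW// wd_radius_gt0.
have aw n m : (n <= m)%N -> wd_ball (w n) (a m).
  move=> nm; apply: (wdec n (m - n)%N) => //; rewrite subnKC//.
  by apply: weak_ball_center; [exact: wd_duals|exact: wd_radius_gt0].
have : cvg (a @ \oo).
  (* From stage [n.+1] on, all centres lie within [n.+1%:R^-1] of [a n.+1]. *)
  apply: cauchy_cvg; apply: cauchy_exP => d d0; have [n nd] := small _ d0.
  exists (a n.+1); exists n.+1 => // m /= nm.
  rewrite -ball_normE /=; apply: lt_trans nd.
  by have [] := wS n _ (aB m) (aw _ _ nm).
move=> /cvg_ex [z az].
have zB : B z.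
  apply: (@closed_cvg _ _ \oo _ a _ (@norm_le_closed K X 1)) az.
  by apply: nearW => n; exact: aB.
have zw n : wd_ball (w n) z.
  (* Later centres lie in the half-radius closed ball, which is norm closed and so contains [z]. *)
  have : weak_closed_ball (wd_seq (w n)) (a n) (wd_radius (w n) / 2) z.
    apply: (@closed_cvg _ _ \oo _ a _
      (@weak_closed_ball_closed K X _ (a n) (wd_radius (w n) / 2)
        (@wd_duals (w n))) _ _ az).
    exists n.+1 => // m /= nm f fs.
    by have [H _] := wS n _ (aB m) (aw _ _ nm); exact/ltW/H.
  move=> H f fs; apply: le_lt_trans (H f fs) _.
  by rewrite ltr_pdivrMr// ltr_pMr ?ltr1n// wd_radius_gt0.
exists z; split; last by apply: sU; have := zw 0%N; rewrite /wd_ball /w u0.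
split => //; move=> V /nbhs_ballP [d /= d0 dV].
have [n nd] := small _ (divr_gt0 d0 (ltr0n _ 2)).
rewrite /within /=.
(* In this weak neighbourhood of [z], points of [B] are within [d / 2] of [a n.+1], as is [z]
   itself. *)
have : nbhs (z : weak X) (wd_ball (w n.+1)).
  by apply: open_nbhs_nbhs; split; [exact/weak_ball_open/wd_duals|exact: zw].
apply: filterS => y yw yB; apply: dV; rewrite -ball_normE /=.
rewrite -(subrKA (a n.+1)) (le_lt_trans (ler_normD _ _))// (splitr d) ltrD//.
  by rewrite distrC; have [_ /lt_trans] := wS n z zB (zw _); apply.
by have [_ /lt_trans] := wS n y yB yw; apply.
Qed.

End Density.

Theorem proposition4p18 (R : realType) (K : numFieldType)
    (hK : real_or_complex R K) (X : completeNormedModType K)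
    (hX : infinite_dimensional X) :
  (CPCP X -> weakly_dense_in (PC (unit_ball X)) (unit_ball X)) /\
  (weakly_dense_in (PC (unit_ball X)) (unit_ball X) ->
   forall x : X, unit_sphere X x -> gateaux_point x -> ~ super_AD x).
Proof.
(* The choice between [R] and [R[i]] enters only through these three properties. *)
have [norming circ small] :
    [/\ norming_functionals K, circle_attained K & small_inverses K].
  case: hK => hKR; subst K.
    split; [exact: real_norming_functionals|exact: real_circle_attained|].
    exact: real_small_inverses.
  split; [exact: complex_norming_functionals|exact: complex_circle_attained|].
  exact: complex_small_inverses.
split; first exact: CPCP_weakly_dense.
by move=> dense x _; exact: gateaux_not_super_AD.
Qed.
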